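(* Let $(X,d,\mu)$ be a metric measure space and let $B_0$ be a fixed ball of radius $r_0$. Assume that the measure $\mu$ has a lower bound, that is, there exist constants $b,Q>0$ such that $\mu(B(x,r))\ge b r^Q$ whenever $B(x,r)\subset 2B_0$. Let $u\in \dot{N}^s_{p,q}(2B_0)$ and $\vec g=(g_j)_{j\in\mathbb{Z}}\in\mathbb{D}^s(u)$, where $0<p,q,s<\infty$ and $q\le p$. Then there exist constants $C,C_1,C_2$ and $C_3$ such that the following hold. 1. If $0<sp<Q$, then $u\in L^{p^*}(B_0)$, $p^*=\frac{Qp}{Q-sp}$, and $$\inf_{a\in\mathbb{R}}\left(\frac{1}{\mu(B_0)}\int_{B_0}|u-a|^{p^*}\,d\mu\right)^{\frac{1}{p^*}}\le C\left(\frac{\mu(2B_0)}{b r_0^Q}\right)^{1/p} r_0^{s}\left(\sum_{j=-\infty}^{\infty}\left(\frac{1}{\mu(2B_0)}\int_{2B_0}g_j^p\,d\mu\right)^{\frac{q}{p}}\right)^{\frac{1}{q}}.$$ 2. If $sp=Q$, then $$\frac{1}{\mu(B_0)}\int_{B_0}\exp\left(C_1 b^{1/Q}\,\frac{|u-u_{B_0}|}{\|\vec g\|_{l^q(L^p(2B_0))}}\right)d\mu\le C_2.$$ 3. If $sp>Q$, then $$\|u-u_{B_0}\|_{L^\infty(B_0)}\le C_3\left(\frac{\mu(2B_0)}{b r_0^Q}\right)^{1/p} r_0^{s}\left(\sum_{j=-\infty}^{\infty}\left(\frac{1}{\mu(2B_0)}\int_{2B_0}g_j^p\,d\mu\ri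ght)^{\frac{q}{p}}\right)^{\frac{1}{q}}.$$
   Context: A metric measure space $(X,d,\mu)$ is a metric space $(X,d)$ equipped with a Borel regular measure $\mu$ on $X$ such that all balls defined by $d$ have finite and positive measure. $B(x,r)$ is the ball with center $x$ and radius $r$, and $2B_0$ is the ball with the same center as $B_0$ and twice its radius. $u_{B_0}=\frac{1}{\mu(B_0)}\int_{B_0}u\,d\mu$ is the integral average of $u$ over $B_0$. Let $S\subset X$ be a measurable set and let $0<s<\infty$. A sequence $(g_k)_{k\in\mathbb{Z}}$ of nonnegative measurable functions is a fractional $s$-gradient of a measurable function $u:S\to[-\infty,\infty]$ in $S$ if there exists a set $E\subset S$ with $\mu(E)=0$ such that $$|u(x)-u(y)|\le d(x,y)^s\big(g_k(x)+g_k(y)\big)$$ for all $k\in\mathbb{Z}$ and all $x,y\in S\setminus E$ satisfying $2^{k-1}\le d(x,y)<2^k$. The collection of all fractional $s$-gradients of $u$ is denoted by $\mathbb{D}^s(u)$; in the claim, $S=2B_0$. For $0<p,q<\infty$ and a sequence $\vec f=(f_k)_{k\in\mathbb{Z}}$ of measurable functions, put $$\|\vec f\|_{l^q(L^p(S))}=\left(\sum_{k\in\mathbb{Z}}\|f_k\|_{L^p(S)}^q\right)^{1/q}.$$ The homogeneous Hajłasz-Besov space $\dot N^s_{p,q}(S)$ consists of the measurable functions $u:S\to[-\infty,\infty]$ for which the (semi)norm $\|u\|_{\dot N^s_{p,q}(S)}=\inf_{\vec g\in\mathbb{D}^s(u)}\|\vec g\|_{l^q(L^p(S))}$ is finite.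
   Formalization: If 2B_0 is the single point x_0, u(x_0) is assumed finite: otherwise u=+∞ there has zero seminorm but is not in L^{p*}(B_0). The constant C_1 may depend on b (unavoidable when s≠1, by scaling the measure); the others depend only on s,p,q,Q. *)

(* Defs.v *)
From HB Require Import structures.
From mathcomp Require Import all_boot all_order all_algebra.
From mathcomp Require Import all_classical all_reals all_analysis.
From mathcomp Require Import measurable_realfun.

Set Implicit Arguments.
Unset Strict Implicit.
Unset Printing Implicit Defensive.

Import Order.TTheory GRing.Theory Num.Theory.
Import numFieldNormedType.Exports.

Local Open Scope classical_set_scope.
Local Open Scope ring_scope.
Local Open Scope ereal_scope.

(* A metric space with a sigma-algebra; the two structures are tied together
   by [metric_measure_space] below. *)
#[short(type="metricMeasurableType")]
HB.structure Definition MetricMeasurable (d : measure_display) (R : realType) :=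
  {T of Metric R T & Measurable d T}.

Section hajlasz_besov.
Context {d : measure_display} {R : realType} {X : metricMeasurableType d R}.
Variable mu : {measure set X -> \bar R}.

(* The sigma-algebra contains the Borel sets and every measurable set has a
   Borel hull of the same measure (Borel regularity). It may be the Borel
   sigma-algebra itself or that of the Caratheodory-measurable sets of a Borel
   regular outer measure. *)
Definition metric_measure_space : Prop :=
  [/\ forall U : set X, open U -> d.-measurable U,
      forall A : set X, d.-measurable A ->
        exists B : set X, [/\ <<s [set U : set X | open U] >> B,
                              A `<=` B & mu B = mu A] &
      forall (x : X) (r : R), (0 < r)%R ->
        0 < mu (ball x r) /\ mu (ball x r) < +oo].

(* Functions on S are represented by functions on X of which only the values
   on S matter. *)
Definition in_Lp (p : R) (S : set X) (f : X -> \bar R) : Prop :=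
  measurable_fun S f /\ 'N[mu]_p%:E[f \_ S] < +oo.

Definition average (S : set X) (f : X -> \bar R) : \bar R :=
  (mu S)^-1 * \int[mu]_(x in S) f x.

(* In \bar R, `|u x - u y| = +oo as soon as u x or u y is infinite, including
   when u x = u y = +oo or u x = u y = -oo. *)
Definition fractional_gradient (s : R) (S : set X) (u : X -> \bar R)
    (g : int -> X -> \bar R) : Prop :=
  [/\ forall k, measurable_fun S (g k),
      forall k x, S x -> 0 <= g k x &
      exists E : set X,
        [/\ d.-measurable E, E `<=` S, mu E = 0 &
            forall (k : int) (x y : X), (S `\` E) x -> (S `\` E) y ->
              ((2 : R) ^ (k - 1) <= mdist x y < (2 : R) ^ k)%R ->
              `|u x - u y| <= (mdist x y `^ s)%:E * (g k x + g k y)]].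

Definition lq_Lp_norm (p q : R) (S : set X) (f : int -> X -> \bar R) : \bar R :=
  (\esum_(k in [set: int]) 'N[mu]_p%:E[f k \_ S] `^ q) `^ q^-1.

Definition hajlasz_besov_norm (s p q : R) (S : set X) (u : X -> \bar R) :
    \bar R :=
  ereal_inf [set lq_Lp_norm p q S g | g in fractional_gradient s S u].

Definition hajlasz_besov (s p q : R) (S : set X) (u : X -> \bar R) : Prop :=
  measurable_fun S u /\ hajlasz_besov_norm s p q S u < +oo.

End hajlasz_besov.

(* Main.v *)
Require Import Defs.
From HB Require Import structures.
From mathcomp Require Import all_boot all_order all_algebra.
From mathcomp Require Import all_classical all_reals all_analysis.
From mathcomp Require Import measurable_realfun ess_sup_inf.
From mathcomp Require Import ring lra.

Set Implicit Arguments.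
Unset Strict Implicit.
Unset Printing Implicit Defensive.

Import Order.TTheory GRing.Theory Num.Theory.
Import numFieldNormedType.Exports.

Local Open Scope classical_set_scope.
Local Open Scope ring_scope.
Local Open Scope ereal_scope.

(** Because q <= p, the l^q(L^p) norm of g dominates the L^p norm of the single
    function G^(1/p), where G = sum_k g_k^p (esum_poweR_le,
    integral_lp_gradient_le_norm), and off a null set
      |u x - u y| <= d(x, y)^s (G(x)^(1/p) + G(y)^(1/p)).
    So everything follows from one pointwise gradient w = G^(1/p) in L^p(2B0).

    Fix a height T and consider the levels {w <= T 2^j}. By Markov's inequality
    the part of 2B0 outside level j has measure at most (int G) T^-p 2^(-jp). If
    T^p is slightly larger than a multiple of (int G) / (b r0^Q), this is smaller
    than b r_j^Q, where r_j = r0 (1 - theta) theta^j and theta = 2^(-p/Q). The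
    lower bound on the measure then forces the ball of radius r_j around a point of
    level j + 1 to meet level j. Since sum_j r_j = r0, a point of B0 can be
    joined to level 0 by such steps without leaving 2B0 (chain_down), and level
    0 has oscillation at most a multiple of T r0^s. Hence, for a suitable constant a,
      |u - a| <= const * T r0^s * (1 + sum_(i < j) lambda^i)   on level j,
    with lambda = 2 theta^s = 2^(1 - sp/Q) (oscillation_levels, oscillation).

    Every x lies in some level j with 2^(pj) <= 2^p (1 + (w(x)/T)^p), and the weight
    h = 1 + (w/T)^p has integral at most 2 mu(B0). The three cases of the theorem
    are the three behaviours of the geometric sum. For lambda > 1 it is of order
    lambda^j, whose power P = Qp/(Q - sp) is exactly 2^(pj), so that |u - a|^P is
    bounded by a multiple of h; for lambda = 1 it is 1 + j, so that an exponential
    of |u - a| is bounded by a multiple of h; for lambda < 1 it is bounded, and so is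
    |u - a|. *)

(** * Dyadic scales and geometric sums *)

Lemma powR_exprAC (R : realType) (x y : R) n : (0 <= x)%R ->
  ((x ^+ n) `^ y = (x `^ y) ^+ n)%R.
Proof.
by move=> x0; rewrite -(powR_mulrn _ (powR_ge0 _ _)) -(powR_mulrn _ x0) -!powRrM mulrC.
Qed.

Lemma powR2_gt1 (R : realType) (e : R) : (0 < e)%R -> (1 < (2 : R) `^ e)%R.
Proof.
move=> e0; have := gt0_ltr_powR e0 (x := 1%R) (y := 2%R); rewrite powR1; apply.
- by rewrite nnegrE.
- by rewrite nnegrE.
- by rewrite ltr1n.
Qed.

Lemma dyadic_scale (R : realType) (t : R) : (0 < t)%R ->
  exists k : int, ((2 : R) ^ (k - 1) <= t < (2 : R) ^ k)%R.
Proof.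
move=> t0; have ln2 : (0 < ln (2:R))%R by rewrite ln_gt0// ltr1n.
have e2 (k : int) : ((2 : R) ^ k = expR (k%:~R * ln 2))%R.
  by rewrite -powR_intmul// /powR pnatr_eq0.
exists (Num.floor (ln t / ln 2) + 1)%R; rewrite !e2 addrK.
rewrite -[X in (_ <= X < _)%R](lnK (t0 : t \is Num.pos)) ler_expR ltr_expR.
by rewrite -ler_pdivlMr// -ltr_pdivrMr// floor_le lt_succ_floor.
Qed.

Section geometric.
Context (R : realType).

Lemma geometric_ge1 (l : R) j : (1 < l)%R ->
  (1 + \sum_(i < j) l ^+ i <= (1 + (l - 1)^-1) * l ^+ j)%R.
Proof.
move=> l1; have l10 : (0 < l - 1)%R by rewrite subr_gt0.
rewrite mulrDl mul1r lerD//; first by rewrite exprn_ege1// ltW.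
rewrite ler_pdivlMl//.
by rewrite -subrX1 gerDl.
Qed.

Lemma geometric_le1 (l : R) j : (0 <= l < 1)%R ->
  (\sum_(i < j) l ^+ i <= (1 - l)^-1)%R.
Proof.
move=> /andP[l0 l1]; have l10 : (0 < 1 - l)%R by rewrite subr_gt0.
rewrite -[leRHS]mulr1 ler_pdivlMl//.
by rewrite -opprB mulNr -subrX1 opprB gerDl oppr_le0 exprn_ge0.
Qed.

(** The least [j] whose level contains [t] satisfies [T * 2 ^+ j.-1 < t] unless
    it is [0], which explains both terms of the bound. *)
Lemma dyadic_level (p t T : R) : (0 < p)%R -> (0 < T)%R -> (0 <= t)%R ->
  exists2 j : nat, (t <= T * 2 ^+ j)%R &
    ((2 `^ p) ^+ j <= 2 `^ p * (1 + (t / T) `^ p))%R.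
Proof.
move=> p0 T0 t0.
have tT : (0 <= t / T)%R by rewrite divr_ge0// ltW.
have e2 (j : nat) : (2 ^+ j = expR (j%:R * ln 2) :> R)%R.
  by rewrite -powR_mulrn// /powR pnatr_eq0.
have ex : exists j, (t <= T * 2 ^+ j)%R.
  exists (Num.bound (t / T)); rewrite -ler_pdivrMl// mulrC.
  apply: (le_trans (ltW (archi_boundP tT))).
  by rewrite -natrX ler_nat ltnW// ltn_expl.
case: (ex_minnP ex) => j tj jmin; exists j => //.
case: j tj jmin => [|j] tj jmin.
  by rewrite expr0 mulr_ege1 ?lerDl ?powR_ge0// -[leLHS](powRr0 2) ler_powR ?ler1n// ltW.
rewrite exprS ler_wpM2l ?powR_ge0//.
have : (T * 2 ^+ j < t)%R.
  by rewrite ltNge; apply/negP => /jmin; rewrite ltnn.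
rewrite mulrC -ltr_pdivlMr// => /ltW h.
rewrite -(powR_exprAC _ _ (ler0n R 2)).
rewrite (@le_trans _ _ ((t / T) `^ p))%R ?lerDr//.
by apply: ge0_ler_powR; rewrite ?nnegrE ?exprn_ge0 ?(ltW p0).
Qed.

End geometric.

(** * Chains of balls through the levels of a pointwise gradient *)

Section chaining.
Context d (R : realType) (X : metricMeasurableType d R).
Variable mu : {measure set X -> \bar R}.
Variables (x0 : X) (r0 b Q s theta T : R) (F : set X) (v w : X -> R).
Local Notation B0 := (ball x0 r0).
Local Notation twoB0 := (ball x0 (2 * r0)%R).
Local Notation level t := (F `&` [set x | (w x <= t)%R]).
Hypotheses (r00 : (0 < r0)%R) (b0 : (0 < b)%R) (s0 : (0 < s)%R).
Hypotheses (Q0 : (0 < Q)%R) (th01 : (0 < theta < 1)%R) (T0 : (0 < T)%R).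
Hypothesis mball : forall x r, d.-measurable (ball x r : set X).
Hypothesis lower : forall (x : X) (r : R), (0 < r)%R -> ball x r `<=` twoB0 ->
  (b * r `^ Q)%:E <= mu (ball x r).
Hypothesis FS : F `<=` twoB0.
Hypothesis mlev : forall t, d.-measurable (level t).
Hypothesis vw : forall x y, F x -> F y ->
  (`|v x - v y| <= mdist x y `^ s * (w x + w y))%R.
(** The complement of level [j] is too small to contain the ball of radius
    [r0 * (1 - theta) * theta ^+ j], the [j]-th step of a chain. *)
Hypothesis small : forall j, mu (twoB0 `\` level (T * 2 ^+ j)) <
  (b * (r0 * (1 - theta) * theta ^+ j) `^ Q)%:E.

(** A ball of radius [r0 * (1 - theta) * theta ^+ j] around a point of level
    [j.+1] must meet level [j]; descending one level at a time, the radii add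
    up to [r0 * (1 - theta ^+ j)], which keeps the whole chain inside
    the double ball. The step from level [j.+1] to level [j] costs its
    radius to the power [s] times a height of order [T * 2 ^+ j], hence the
    ratio [2 * theta `^ s]. *)
Lemma chain_down j x : level (T * 2 ^+ j) x ->
  ball x (r0 * (1 - theta ^+ j))%R `<=` twoB0 ->
  exists2 y, level T y &
    (`|v x - v y| <= 4 * T * r0 `^ s * \sum_(i < j) (2 * theta `^ s) ^+ i)%R.
Proof.
have /andP[th0 th1] := th01.
have th1' : (0 < 1 - theta)%R by rewrite subr_gt0.
elim: j x => [|j IH] x.
  rewrite expr0 mulr1 => xl _; exists x => //.
  by rewrite big_ord0 mulr0 subrr normr0.
move=> [Fx wx] ballx.
set r := (r0 * (1 - theta) * theta ^+ j)%R.
have rgt0 : (0 < r)%R by rewrite /r !mulr_gt0// exprn_gt0.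
have rE : (r0 * (1 - theta ^+ j.+1) = r + r0 * (1 - theta ^+ j))%R.
  by rewrite /r exprS; ring.
have R0 : (0 <= r0 * (1 - theta ^+ j))%R.
  by rewrite mulr_ge0 ?(ltW r00)// subr_ge0 exprn_ile1// ltW.
have brx : ball x r `<=` twoB0.
  by apply: subset_trans ballx; apply: le_ball; rewrite rE lerDl.
have [y [yb [Fy wy]]] : exists y, ball x r y /\ level (T * 2 ^+ j) y.
  apply: contrapT => /forallNP h.
  have : ball x r `<=` twoB0 `\` level (T * 2 ^+ j).
    by move=> y yb; split; [exact: brx|move=> ly; apply: (h y)].
  move=> /(le_measure mu); rewrite !inE => /(_ (mball _ _)).
  have mD : d.-measurable (twoB0 `\` level (T * 2 ^+ j)).
    by apply: measurableD => //; exact: mball.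
  move=> /(_ mD) /(le_trans (lower rgt0 brx)).
  by rewrite leNgt small.
have [|z [Fz wz] vyz] := IH y (conj Fy wy).
  apply: subset_trans ballx => z yz.
  by rewrite rE; apply: ball_triangle yz.
exists z => //.
rewrite -(subrKA (v y)); apply: (le_trans (ler_normD _ _)).
rewrite big_ord_recr/= mulrDr addrC; apply: lerD => //.
apply: (le_trans (vw Fx Fy)).
have dr : (mdist x y <= r)%R by move: yb; rewrite ballEmdist/= => /ltW.
have drs : (mdist x y `^ s <= r0 `^ s * (theta `^ s) ^+ j)%R.
  rewrite -(powR_exprAC _ _ (ltW th0)) -powRM ?exprn_ge0 ?(ltW r00) ?(ltW th0)//.
  have r00j : (0 <= r0 * theta ^+ j)%R by rewrite mulr_ge0 ?exprn_ge0 ?(ltW r00) ?(ltW th0).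
  apply: ge0_ler_powR; rewrite ?nnegrE ?mdist_ge0 ?(ltW s0) //.
  apply: (le_trans dr); rewrite ler_wpM2r ?exprn_ge0 ?(ltW th0)//.
  by rewrite ger_pMr// gerDl oppr_le0 ltW.
have wxy : (w x + w y <= 4 * T * 2 ^+ j)%R.
  have := lerD wx wy; rewrite exprS => /le_trans; apply.
  have : (0 < T * 2 ^+ j)%R by rewrite mulr_gt0// exprn_gt0.
  by move=> ?; lra.
rewrite exprMn.
rewrite [leRHS](_ : _ = (r0 `^ s * theta `^ s ^+ j) * (4 * T * 2 ^+ j))%R; last by ring.
apply: (le_trans (ler_wpM2l (powR_ge0 _ _) wxy)).
by apply: ler_wpM2r => //; rewrite !mulr_ge0 ?exprn_ge0// ltW.
Qed.

(** Two points of level [0] in the double ball are at distance at most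
    [4 * r0], so the value of [v] at any point of that level can serve
    as [a]; chains carry the estimate to the higher levels. *)
Lemma oscillation_levels :
  exists a : R, forall j x, B0 x -> level (T * 2 ^+ j) x ->
    (`|v x - a| <= 4 * 4 `^ s * T * r0 `^ s *
                   (1 + \sum_(i < j) (2 * theta `^ s) ^+ i))%R.
Proof.
have /andP[th0 th1] := th01.
have B02 : ball x0 r0 `<=` twoB0 by apply: le_ball; rewrite ler_peMl ?ler1n// ltW.
have dist2 x y : twoB0 x -> twoB0 y -> (mdist x y <= 4 * r0)%R.
  rewrite !ballEmdist/= => x2 y2.
  have := metric_triangle x x0 y; rewrite (metric_sym x x0) => /le_trans; apply.
  by lra.
have [y0 [_ ly0]] : exists y, ball x0 r0 y /\ level T y.
  apply: contrapT => /forallNP h.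
  have : ball x0 r0 `<=` twoB0 `\` level T.
    by move=> y yb; split; [exact: B02|move=> ly; apply: (h y)].
  move=> /(le_measure mu); rewrite !inE => /(_ (mball _ _)).
  have mD : d.-measurable (twoB0 `\` level T).
    by apply: measurableD => //; exact: mball.
  move=> /(_ mD) /(le_trans (lower r00 B02)).
  rewrite leNgt; apply/negP/negPn.
  have := small 0%N; rewrite !expr0 !mulr1 => /lt_le_trans; apply.
  rewrite lee_fin ler_wpM2l ?(ltW b0)//.
  have r1 : (0 <= r0 * (1 - theta))%R by rewrite mulr_ge0 ?subr_ge0 ?(ltW r00) ?(ltW th1).
  by apply: ge0_ler_powR; rewrite ?nnegrE ?(ltW Q0) ?(ltW r00)// ger_pMr// gerDl oppr_le0 ltW.
exists (v y0) => j x xB lx.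
have [|y ly vxy] := chain_down lx.
  move=> z xz; rewrite mulrDl mul1r; apply: ball_triangle xB _.
  by apply: le_ball xz; rewrite ger_pMr// gerDl oppr_le0 exprn_ge0// ltW.
rewrite -(subrKA (v y)); apply: (le_trans (ler_normD _ _)).
rewrite mulrDr mulr1 addrC; apply: lerD.
  have [[Fy wy] [Fy0 wy0]] := (ly, ly0).
  apply: (le_trans (vw Fy Fy0)).
  have h1 : (mdist y y0 `^ s <= 4 `^ s * r0 `^ s)%R.
    rewrite -powRM ?(ltW r00)//; apply: ge0_ler_powR;
      by rewrite ?nnegrE ?(ltW s0) ?mdist_ge0 ?mulr_ge0 ?(ltW r00)// dist2//; exact: FS.
  have h2 : (w y + w y0 <= 4 * T)%R by have := T0; move: wy wy0 => /=; lra.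
  apply: (le_trans (ler_wpM2l (powR_ge0 _ _) h2)).
  rewrite [leRHS](_ : _ = (4 `^ s * r0 `^ s) * (4 * T))%R; last by ring.
  by apply: ler_wpM2r => //; rewrite mulr_ge0 ?(ltW T0).
apply: (le_trans vxy); apply: ler_wpM2r.
  by apply: sumr_ge0 => i _; rewrite exprn_ge0// mulr_ge0// powR_ge0.
apply: ler_wpM2r; first exact: powR_ge0.
apply: ler_wpM2r; first exact: ltW.
rewrite ler_peMr//.
by rewrite -[leLHS](powRr0 4) ler_powR ?ler1n// ltW.
Qed.

End chaining.

(** * The pointwise gradient of a sequence of gradients *)

(** Monotone convergence concerns series indexed by [nat]; this enumeration
    of [int] transports it to sums over all dyadic scales. *)
Definition int_of_index (n : nat) : int := if odd n then Negz n./2 else Posz n./2.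

Lemma int_of_index_bij : set_bij [set: nat] [set: int] int_of_index.
Proof.
split=> //.
- move=> m n _ _; rewrite /int_of_index => h.
  rewrite -(odd_double_half m) -(odd_double_half n).
  by case: (odd m) h; case: (odd n) => // -[->].
- move=> [n|n] _.
    by exists n.*2 => //; rewrite /int_of_index odd_double doubleK.
  by exists n.*2.+1 => //; rewrite /int_of_index /= odd_double /= uphalf_double.
Qed.

Lemma esum_int (R : realType) (a : int -> \bar R) : (forall k, 0 <= a k) ->
  \esum_(k in [set: int]) a k = \sum_(n <oo) a (int_of_index n).
Proof.
by move=> a0; rewrite (reindex_esum _ _ _ _ int_of_index_bij)// nneseries_esumT.
Qed.

(** With [N] the sum of the [a i `^ q], every term satisfies
    [a i `^ q <= N], hence [a i `^ p <= a i `^ q * N `^ ((p - q) / q)]; this is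
    where [q <= p] enters the whole proof. *)
Lemma esum_poweR_le (R : realType) (I : choiceType) (a : I -> \bar R) (p q : R) :
  (0 < q)%R -> (q <= p)%R -> (forall i, 0 <= a i) ->
  \esum_(i in [set: I]) a i `^ p <=
    ((\esum_(i in [set: I]) a i `^ q) `^ q^-1) `^ p.
Proof.
move=> q0 qp a0; have p0 : (0 < p)%R by exact: lt_le_trans qp.
set N := \esum_(i in _) a i `^ q.
have N0 : 0 <= N by apply: esum_ge0 => i _; exact: poweR_ge0.
have aN i : a i `^ q <= N.
  have <- : \sum_(j \in [set i]) a j `^ q = a i `^ q by rewrite fsbig_set1.
  by apply: ereal_sup_ubound; exists [set i].
case: (eqVneq N +oo) => [->|Noo].
  by rewrite poweRyr ?invr_eq0 ?gt_eqF// poweRyr ?gt_eqF// leey.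
have Nfin : N \is a fin_num by rewrite fin_real// ltey Noo (lt_le_trans _ N0) ?ltNyr.
rewrite -poweRrM.
have -> : N `^ (q^-1 * p) = N * N `^ ((p - q) / q).
  have pq : (q^-1 * p = 1 + (p - q) / q)%R by field; rewrite gt_eqF.
  rewrite pq poweRD ?poweRe1// /poweRD_def -pq gt_eqF//.
  by rewrite mulr_gt0// invr_gt0.
apply: ge_ereal_sup => _ [A [finA _] <-].
apply: (@le_trans _ _ (\sum_(i \in A) a i `^ q * N `^ ((p - q) / q))).
  apply: lee_fsum => // i _.
  have pE : (p = q + (p - q))%R by rewrite addrC subrK.
  rewrite {1}pE poweRD; last by rewrite /poweRD_def -pE gt_eqF.
  rewrite lee_wpmul2l ?poweR_ge0//.
  have pqE : (p - q = q * ((p - q) / q))%R by field; rewrite gt_eqF.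
  rewrite {1}pqE poweRrM.
  apply: gt0_ler_poweR; rewrite ?in_itv/= ?poweR_ge0 ?leey ?N0//.
  by rewrite divr_ge0 ?subr_ge0 ?(ltW q0).
rewrite -ge0_mule_fsuml; last by move=> i; exact: poweR_ge0.
rewrite lee_wpmul2r ?poweR_ge0//.
by apply: ereal_sup_ubound; exists A.
Qed.

Section gradient.
Context d (R : realType) (X : metricMeasurableType d R).
Variable mu : {measure set X -> \bar R}.

(** Any single [g k x] is at most [lp_gradient p g x `^ p^-1], so the latter serves
    all scales at once, while the integral of [lp_gradient p g] is still a
    sum of the integrals of the [g k `^ p]. *)
Definition lp_gradient (p : R) (g : int -> X -> \bar R) (x : X) : \bar R :=
  \esum_(k in [set: int]) g k x `^ p.

Variables (s p q : R) (S : set X) (u : X -> \bar R) (g : int -> X -> \bar R).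
Hypothesis mS : d.-measurable S.
Hypothesis gradg : fractional_gradient mu s S u g.

Lemma measurable_gradient_poweR k : measurable_fun S (fun x => g k x `^ p).
Proof.
have [mg _ _] := gradg.
by apply: (measurableT_comp (measurable_poweR _)); exact: mg.
Qed.

Lemma lp_gradientE x :
  lp_gradient p g x = \sum_(n <oo) g (int_of_index n) x `^ p.
Proof. by apply: esum_int => k; exact: poweR_ge0. Qed.

Lemma measurable_lp_gradient : measurable_fun S (lp_gradient p g).
Proof.
rewrite (funext lp_gradientE).
apply: ge0_emeasurable_sum => [n x _ _|n _]; first exact: poweR_ge0.
exact: measurable_gradient_poweR.
Qed.

Lemma lp_gradient_ge0 x : 0 <= lp_gradient p g x.
Proof. by apply: esum_ge0 => k _; exact: poweR_ge0. Qed.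

Lemma integral_lp_gradient : \int[mu]_(x in S) lp_gradient p g x =
  \esum_(k in [set: int]) \int[mu]_(x in S) g k x `^ p.
Proof.
rewrite esum_int; last by move=> k; apply: integral_ge0 => x _; exact: poweR_ge0.
under eq_integral do rewrite lp_gradientE.
rewrite integral_nneseries// => n; first exact: measurable_gradient_poweR.
by move=> x _; exact: poweR_ge0.
Qed.

Lemma integral_lp_gradient_le_norm : (0 < q)%R -> (q <= p)%R ->
  \int[mu]_(x in S) lp_gradient p g x <= lq_Lp_norm mu p q S g `^ p.
Proof.
move=> q0 qp; have p0 : (0 < p)%R by exact: lt_le_trans qp.
rewrite integral_lp_gradient /lq_Lp_norm.
have [_ g0 _] := gradg.
apply: le_trans (esum_poweR_le q0 qp _); last by move=> k; exact: Lnorm_ge0.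
apply: le_esum => k _; rewrite poweR_Lnorm ?gt_eqF// [leLHS]integral_mkcond.
rewrite le_eqVlt; apply/orP; left; apply/eqP; apply: eq_integral => x _ /=.
rewrite /patch; case: ifPn => [/set_mem Sx|_]; first by rewrite gee0_abs// g0.
by rewrite abse0 poweR0r// gt_eqF.
Qed.

Lemma integral_lp_gradient_le_average : (0 < q)%R -> (q <= p)%R ->
  0 < mu S < +oo ->
  \int[mu]_(x in S) lp_gradient p g x <=
  mu S * ((\esum_(j in [set: int])
         (average mu S (fun x => g j x `^ p)) `^ (q / p)) `^ q^-1) `^ p.
Proof.
move=> q0 qp /andP[S0 Soo]; have p0 : (0 < p)%R by exact: lt_le_trans qp.
have Sfin : mu S \is a fin_num by rewrite ge0_fin_numE// ltW.
have avg0 k : 0 <= average mu S (fun x => g k x `^ p).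
  apply: mule_ge0; first by rewrite inve_ge0 ltW.
  by apply: integral_ge0 => x _; exact: poweR_ge0.
rewrite integral_lp_gradient.
pose a k := average mu S (fun x => g k x `^ p) `^ p^-1.
have aE k : a k `^ q = average mu S (fun x => g k x `^ p) `^ (q / p).
  by rewrite /a -poweRrM mulrC.
under [X in (X `^ q^-1) `^ p]eq_esum do rewrite -aE.
have := esum_poweR_le q0 qp (fun k => poweR_ge0 (average mu S (fun x => g k x `^ p)) p^-1).
rewrite -/a => /(lee_wpmul2l (ltW S0)); apply: le_trans.
have -> : \esum_(k in [set: int]) \int[mu]_(x in S) g k x `^ p =
   \esum_(k in [set: int]) (mu S * a k `^ p).
  apply: eq_esum => k _; rewrite /a -poweRrM mulVf ?gt_eqF// poweRe1//.
  by rewrite /average muleA divee ?mul1e// gt_eqF.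
rewrite !esum_int; [|by move=> k; rewrite ?mule_ge0 ?poweR_ge0..].
by rewrite -(fineK Sfin) nneseriesZl// => n _; exact: poweR_ge0.
Qed.

(** Two distinct points have a positive distance, which lies in exactly one
    dyadic shell; the gradient inequality is applied at that shell. *)
Lemma lp_gradientP : (0 < p)%R -> exists E : set X, [/\ d.-measurable E, E `<=` S, mu E = 0 &
  forall x y, x != y -> (S `\` E) x -> (S `\` E) y ->
  `|u x - u y| <= (mdist x y `^ s)%:E *
    (lp_gradient p g x `^ p^-1 + lp_gradient p g y `^ p^-1)].
Proof.
move=> p0.
have [_ g0 [E [mE ES E0 hE]]] := gradg.
exists E; split=> // x y xy Sx Sy.
have [k /(hE k x y Sx Sy)] : exists k : int, ((2 : R) ^ (k - 1) <= mdist x y < (2 : R) ^ k)%R.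
  by apply: dyadic_scale; rewrite mdist_gt0.
move=> /le_trans; apply; apply: lee_wpmul2l; first by rewrite lee_fin powR_ge0.
have gk z : (S `\` E) z -> g k z <= lp_gradient p g z `^ p^-1.
  move=> [Sz _].
  rewrite -[leLHS]poweRe1 ?g0// -(divff (lt0r_neq0 p0)) poweRrM.
  apply: gt0_ler_poweR; rewrite ?invr_ge0 ?(ltW p0)// ?in_itv/= ?leey ?poweR_ge0 ?lp_gradient_ge0//.
  have <- : \sum_(j \in [set k]) g j z `^ p = g k z `^ p by rewrite fsbig_set1.
  by apply: ereal_sup_ubound; exists [set k].
by apply: leeD; exact: gk.
Qed.

End gradient.

(** * Restriction to a set of full measure *)

Section full_measure.
Context d (R : realType) (X : metricMeasurableType d R).
Variable mu : {measure set X -> \bar R}.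

Lemma open_mball (x : X) (r : R) : open (ball x r).
Proof.
rewrite openE => y /= xy; apply/nbhs_ballP.
have d0 : (0 < r - mdist x y)%R by move: xy; rewrite ballEmdist/= subr_gt0.
exists (r - mdist x y)%R => // z.
rewrite !ballEmdist/= ltrBrDl; apply: le_lt_trans; exact: metric_triangle.
Qed.

Lemma measurable_mball (x : X) (r : R) : metric_measure_space mu -> d.-measurable (ball x r).
Proof. by move=> [mo _ _]; apply: mo; exact: open_mball. Qed.

(** Balls have positive measure, so a set of full measure is dense. *)
Lemma full_measure_singleton (x : X) (S F : set X) : metric_measure_space mu ->
  open S -> d.-measurable S -> d.-measurable F -> mu (S `\` F) = 0 ->
  (forall y, F y -> y = x) -> S `<=` [set x].
Proof.
move=> mms oS mS mF SF0 Fx z Sz /=; apply: contrapT => zx.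
have zx0 : (0 < mdist z x)%R by rewrite mdist_gt0; apply/eqP.
have [e /= e0 zS] : exists2 e : R, (0 < e)%R & ball z e `<=` S.
  by apply/nbhs_ballP; apply: open_nbhs_nbhs.
(* A ball around z that avoids x lies outside F, yet has positive measure. *)
pose r := Num.min e (mdist z x).
have r0 : (0 < r)%R by rewrite lt_min e0 zx0.
have [_ _ /(_ z r r0) [+ _]] := mms; rewrite ltNge -SF0 => /negP; apply.
apply: le_measure; rewrite ?inE; [exact: measurable_mball|exact: measurableD|].
move=> y zy; split.
  by apply: zS; apply: le_ball zy; rewrite ge_min lexx.
move=> /Fx yx; move: zy; rewrite yx ballEmdist/= lt_min => /andP[_].
by rewrite ltxx.
Qed.

Variables (s p : R) (S : set X) (u : X -> \bar R) (g : int -> X -> \bar R).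

(** [F] is the set where the gradient inequality holds and [lp_gradient] is finite.
    Comparing [x] in [F] with another point of [F] shows that [u x] is finite. If
    there is no other point, then [S] is a singleton, and the assumption on
    [u x0] applies. The last clause is Markov's inequality. *)
Lemma full_measure_gradient (x0 : X) : (0 < p)%R -> metric_measure_space mu ->
  open S -> S x0 -> (S = [set x0] -> u x0 \is a fin_num) ->
  fractional_gradient mu s S u g ->
  \int[mu]_(x in S) lp_gradient p g x < +oo ->
  let w := fun x => (fine (lp_gradient p g x) `^ p^-1)%R in
  exists F : set X, [/\ d.-measurable F, mu (S `\` F) = 0,
    forall x, F x -> [/\ S x, u x \is a fin_num & lp_gradient p g x \is a fin_num],
    forall x y, F x -> F y ->
      (`|fine (u x) - fine (u y)| <= mdist x y `^ s * (w x + w y))%R &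
    forall t, d.-measurable (F `&` [set x | (w x <= t)%R]) /\
      ((0 < t)%R ->
      (t `^ p)%:E * mu (S `\` (F `&` [set x | (w x <= t)%R])) <=
        \int[mu]_(x in S) lp_gradient p g x)].
Proof.
move=> p0 mms oS Sx0 ux0 gradg Aoo w.
have mS : d.-measurable S by have [mo _ _] := mms; exact: mo.
have mG := @measurable_lp_gradient _ _ _ mu s p S u g gradg.
have G0 := @lp_gradient_ge0 _ _ X p g.
have [E [mE ES E0 hE]] := @lp_gradientP _ _ _ mu s p S u g gradg p0.
have iG : mu.-integrable S (lp_gradient p g).
  apply/integrableP; split => //.
  by under eq_integral do rewrite gee0_abs//.
pose F := (S `\` E) `&` [set x | lp_gradient p g x \is a fin_num].
have mGE : measurable_fun (S `\` E) (lp_gradient p g) by apply: measurable_funS mG.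
have mF : d.-measurable F.
  by apply: emeasurable_fin_num => //; exact: measurableD.
have FS : F `<=` S by move=> x [[]].
have F0 : mu (S `\` F) = 0.
  have [N [mN N0 SN]] := integrable_ae mS iG.
  apply/eqP; rewrite -measure_le0 -[leRHS](_ : mu (E `|` N) = 0); last first.
    by rewrite measureU0.
  apply: le_measure; rewrite ?inE; [exact: measurableD|exact: measurableU|].
  move=> x [Sx Fx]; have [Ex|Ex] := pselect (E x); first by left.
  by right; apply: SN => /= /(_ Sx) h; apply: Fx; split.
have wE x : F x -> lp_gradient p g x `^ p^-1 = (w x)%:E.
  by move=> [_ Gx]; rewrite -[in LHS](fineK Gx) poweR_EFin.
have wG x : F x -> lp_gradient p g x = (w x `^ p)%:E.
  move=> [_ Gx]; rewrite /w -powRrM mulVf ?gt_eqF// powRr1 ?fineK//.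
  by apply: fine_ge0; exact: G0.
have ufin x : F x -> u x \is a fin_num.
  move=> Fx; have [[y [Fy yx]]|h] := pselect (exists y, F y /\ x != y).
    have := hE x y yx (proj1 Fx) (proj1 Fy); rewrite !wE//.
    by case: (u x) (u y) => [?||] [?||].
  have Sx : S `<=` [set x].
    apply: (full_measure_singleton mms oS mS mF F0) => y Fy.
    by apply: contrapT => /eqP yx; apply: h; exists y; split => //; rewrite eq_sym.
  have x0x := Sx _ Sx0; rewrite -x0x; apply: ux0; apply/seteqP; split => [y /Sx ->//|y ->//].
exists F; split => //.
- by move=> x Fx; split; [exact: FS|exact: ufin|case: Fx].
- move=> x y Fx Fy; have [->|xy] := eqVneq x y.
    by rewrite subrr normr0 mulr_ge0 ?addr_ge0 ?powR_ge0.
  have := hE x y xy (proj1 Fx) (proj1 Fy); rewrite !wE//.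
  by rewrite -(fineK (ufin _ Fx)) -(fineK (ufin _ Fy)).
- move=> t.
  have mFt : d.-measurable (F `&` [set x | (w x <= t)%R]).
    have -> : F `&` [set x | (w x <= t)%R] =
        F `&` [set x | lp_gradient p g x `^ p^-1 <= t%:E].
      by apply/seteqP; split => x [Fx] /=; rewrite wE.
    apply: emeasurable_fun_infty_c => //.
    apply: (measurableT_comp (measurable_poweR _)).
    exact: measurable_funS mG.
  split => // t0.
  have mM : d.-measurable (S `&` [set x | (t `^ p)%:E <= `|lp_gradient p g x|]).
    by apply: emeasurable_fun_c_infty => //; exact: measurableT_comp.
  have := le_integral_comp_abse mu mS (@measurable_id _ _ _)
    (fun r r0 => r0) (fun _ _ _ _ h => h) mG (powR_gt0 p t0).
  rewrite (eq_integral (lp_gradient p g)); last by move=> x _; rewrite gee0_abs.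
  apply: le_trans; apply: lee_wpmul2l; first by rewrite lee_fin powR_ge0.
  rewrite -(measureU0 mM _ F0); last exact: measurableD.
  apply: le_measure; rewrite ?inE.
  + exact: measurableD.
  + by apply: measurableU => //; exact: measurableD.
  move=> x [Sx Fx]; have [Fx'|] := pselect (F x); last by right.
  left; split => //=; rewrite gee0_abs// wG// lee_fin.
  apply: ge0_ler_powR; rewrite ?nnegrE ?powR_ge0 ?(ltW p0) ?(ltW t0)//.
  by rewrite leNgt; apply/negP => /ltW wt; apply: Fx.
Qed.

End full_measure.

(** * Oscillation on the levels of the pointwise gradient *)

Section oscillation.
Context d (R : realType) (X : metricMeasurableType d R).
Variable mu : {measure set X -> \bar R}.

(** The exponent makes [2 `^ p * theta `^ Q = 1]: the Markov bound for the
    complement of level [j] decays like [2 `^ (- p * j)], and the measure of a ball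
    of radius proportional to [theta ^+ j] is at least of the order of
    [theta `^ (Q * j)]. *)
Definition chain_ratio (p Q : R) : R := (2 `^ (- (p / Q)))%R.

Lemma chain_ratio_bound (p Q : R) : (0 < p)%R -> (0 < Q)%R -> (0 < chain_ratio p Q < 1)%R.
Proof.
move=> p0 Q0; rewrite /chain_ratio powR_gt0//= powRN invf_lt1 ?powR_gt0//.
by rewrite powR2_gt1// divr_gt0.
Qed.

Lemma chain_ratio_powR (p Q : R) : (0 < Q)%R -> (2 `^ p * chain_ratio p Q `^ Q = 1)%R.
Proof.
move=> Q0; rewrite /chain_ratio -powRrM mulNr divfK ?gt_eqF//.
by rewrite powRN mulfV// gt_eqF// powR_gt0.
Qed.

Definition weight (p T : R) (g : int -> X -> \bar R) (x : X) : \bar R :=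
  1 + (T `^ (- p))%:E * lp_gradient p g x.

Lemma weight_ge0 p T g x : 0 <= weight p T g x.
Proof.
by apply: adde_ge0 => //; apply: mule_ge0; rewrite ?lee_fin ?powR_ge0//; exact: lp_gradient_ge0.
Qed.

(** The strict bound on the integral of [lp_gradient] is what makes the
    complements of the levels small in the sense required by chains. The same
    bound, with the lower bound on the measure of the ball, shows that the
    second term of [weight] has an integral of at most the measure of the ball. *)
Lemma oscillation (x0 : X) (r0 b Q s p T : R) (u : X -> \bar R) g :
  let B0 := ball x0 r0 in
  let twoB0 := ball x0 (2 * r0)%R in
  let theta := chain_ratio p Q in
  metric_measure_space mu ->
  (0 < r0)%R -> (0 < b)%R -> (0 < s)%R -> (0 < p)%R -> (0 < Q)%R -> (0 < T)%R ->
  (forall (x : X) (r : R), (0 < r)%R -> ball x r `<=` twoB0 ->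
       (b * r `^ Q)%:E <= mu (ball x r)) ->
  (twoB0 = [set x0] -> u x0 \is a fin_num) ->
  fractional_gradient mu s twoB0 u g ->
  \int[mu]_(x in twoB0) lp_gradient p g x < (b * (r0 * (1 - theta)) `^ Q * T `^ p)%:E ->
  [/\ measurable_fun B0 (weight p T g),
      \int[mu]_(x in B0) weight p T g x <= 2%:E * mu B0 &
  exists (a : R), {ae mu, forall x, B0 x ->
     u x \is a fin_num /\
     exists2 j : nat, ((2 `^ p) ^+ j)%:E <= (2 `^ p)%:E * weight p T g x &
     (`|fine (u x) - a| <= 4 * 4 `^ s * T * r0 `^ s *
                   (1 + \sum_(i < j) (2 * theta `^ s) ^+ i))%R}].
Proof.
move=> B0 twoB0 theta mms r00 b0 s0 p0 Q0 T0 lower ux0 gradg HA.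
have mball x r := measurable_mball x r mms.
have B02 : B0 `<=` twoB0 by apply: le_ball; rewrite ler_peMl ?ler1n// ltW.
have x02 : twoB0 x0 by apply: ballxx; rewrite mulr_gt0.
have th01 : (0 < theta < 1)%R by exact: chain_ratio_bound.
have /andP[th0 th1] := th01.
have mG := @measurable_lp_gradient _ _ _ mu s p _ u g gradg.
have mGB : measurable_fun B0 (lp_gradient p g).
  by apply: measurable_funS (mball _ _) B02 mG.
have G0 := @lp_gradient_ge0 _ _ X p g.
set A := \int[mu]_(x in twoB0) lp_gradient p g x in HA.
split.
- by apply: emeasurable_funD => //; exact: measurable_funeM.
- rewrite /weight ge0_integralD//; first last.
  + exact: measurable_funeM.
  + by move=> x _; rewrite mule_ge0// lee_fin powR_ge0.
  + exact: mball.
  rewrite [X in X + _](integral_cst mu (mball _ _) 1) mul1e.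
  rewrite mule_natl mule2n; apply: leeD => //.
  rewrite ge0_integralZl_EFin ?powR_ge0//; last exact: mball.
  apply: (@le_trans _ _ ((T `^ (- p))%:E * A)).
    apply: lee_wpmul2l; first by rewrite lee_fin powR_ge0.
    by apply: ge0_subset_integral => //; exact: mball.
  apply: le_trans (lower _ _ r00 B02).
  apply: (@le_trans _ _ ((T `^ (- p))%:E * (b * (r0 * (1 - theta)) `^ Q * T `^ p)%:E)).
    by apply: lee_wpmul2l; rewrite ?lee_fin ?powR_ge0// ltW.
  rewrite -EFinM lee_fin powRN mulrC mulfK ?gt_eqF ?powR_gt0//.
  rewrite ler_wpM2l ?(ltW b0)//.
  have r1 : (0 <= r0 * (1 - theta))%R by rewrite mulr_ge0 ?subr_ge0 ?(ltW r00) ?(ltW th1).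
  by apply: ge0_ler_powR; rewrite ?nnegrE ?(ltW Q0) ?(ltW r00)// ger_pMr// gerDl oppr_le0 ltW.
have Aoo : A < +oo by apply: lt_trans HA _; rewrite ltry.
have [F [mF F0 Ffin Fgrad Flev]] :=
  full_measure_gradient p0 mms (open_mball _ _) x02 ux0 gradg Aoo.
set w := fun x => (fine (lp_gradient p g x) `^ p^-1)%R in Fgrad Flev.
have FS : F `<=` twoB0 by move=> x /Ffin[].
have small j : mu (twoB0 `\` (F `&` [set x | (w x <= T * 2 ^+ j)%R])) <
     (b * (r0 * (1 - theta) * theta ^+ j) `^ Q)%:E.
  have Tj0 : (0 < T * 2 ^+ j)%R by rewrite mulr_gt0// exprn_gt0.
  have [_ /(_ Tj0) H] := Flev (T * 2 ^+ j)%R.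
  rewrite ltNge; apply/negP => C; move: HA; rewrite ltNge => /negP; apply.
  apply: le_trans H.
  have := lee_wpmul2l (x := ((T * 2 ^+ j) `^ p)%:E) (powR_ge0 _ _) C; apply: le_trans.
  rewrite -EFinM lee_fin le_eqVlt; apply/orP; left; apply/eqP.
  have r1 : (0 <= r0 * (1 - theta))%R by rewrite mulr_ge0 ?subr_ge0 ?(ltW r00) ?(ltW th1).
  rewrite (powRM _ (ltW T0) (exprn_ge0 j (ler0n R 2))).
  rewrite (powRM _ r1 (exprn_ge0 j (ltW th0))).
  rewrite (powR_exprAC _ _ (ltW th0)) (powR_exprAC _ _ (ler0n R 2)).
  (* The choice of theta cancels all the powers that depend on j. *)
  have : (((2 `^ p) ^+ j) * (theta `^ Q) ^+ j = 1)%R.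
    by rewrite -exprMn chain_ratio_powR// expr1n.
  set x := ((2 `^ p) ^+ j)%R; set y := ((theta `^ Q) ^+ j)%R => xy.
  by rewrite -[LHS]mulr1 -xy; ring.
have [a Ha] := oscillation_levels r00 b0 s0 Q0 th01 T0 mball lower FS
  (fun t => proj1 (Flev t)) Fgrad small.
exists a; exists (twoB0 `\` F); split => //; first by apply: measurableD => //; exact: mball.
move=> x /= /not_implyP[Bx H]; split; first exact: B02.
move=> Fx; apply: H; have [_ ux Gx] := Ffin x Fx; split => //.
have wx0 : (0 <= w x)%R by exact: powR_ge0.
have [j wj jw] := dyadic_level p0 T0 wx0.
exists j; last by apply: Ha => //; split.
rewrite (le_trans (_ : _ <= (2 `^ p * (1 + (w x / T) `^ p))%:E)) ?lee_fin//.
rewrite EFinM; apply: lee_wpmul2l; first by rewrite lee_fin powR_ge0.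
rewrite /weight -(fineK Gx) -EFinM -EFinD lee_fin lerD2l.
rewrite powRM ?invr_ge0 ?(ltW T0)// /w -powRrM mulVf ?gt_eqF// powRr1; last first.
  by apply: fine_ge0; exact: G0.
by rewrite mulrC -(powR_inv1 (ltW T0)) -powRrM mulN1r.
Qed.

End oscillation.

(** * Averages *)

Lemma measurable_expeR (R : realType) : measurable_fun [set: \bar R] (@expeR R).
Proof.
have -> : @expeR R = (fun x => maxe 0 (er_map (@expR R) x)).
  apply/funext => -[r||] /=.
  - by rewrite max_r// lee_fin expR_ge0.
  - by rewrite max_r// leey.
  - by rewrite max_l// leNye.
apply: measurable_maxe => //.
exact: (@measurable_er_map _ (measurableTypeR R) R _ (@measurable_expR R)).
Qed.

Section averages.
Context d (R : realType) (X : metricMeasurableType d R).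
Variable mu : {measure set X -> \bar R}.
Variable (B : set X).
Hypotheses (mB : d.-measurable B) (B_gt0 : 0 < mu B) (B_fin : mu B < +oo).

Lemma average_le (f H : X -> \bar R) (c : R) :
  measurable_fun B f -> measurable_fun B H ->
  (forall x, B x -> 0 <= f x) -> (forall x, B x -> 0 <= H x) ->
  {ae mu, forall x, B x -> f x <= H x} ->
  \int[mu]_(x in B) H x <= c%:E * mu B -> average mu B f <= c%:E.
Proof.
move=> mf mH f0 H0 fH Hc.
have Bfin : mu B \is a fin_num by rewrite ge0_fin_numE// ltW.
rewrite /average.
rewrite -[leRHS](_ : (mu B)^-1 * (c%:E * mu B) = _); last first.
  by rewrite muleC -muleA divee ?mule1// gt_eqF.
apply: lee_wpmul2l; first by rewrite inve_ge0 ltW.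
apply: le_trans Hc; exact: ae_ge0_le_integral.
Qed.

(** Integrating [f - a] shows at the same time that [f] is integrable. *)
Lemma average_near (f H : X -> \bar R) (a c : R) :
  measurable_fun B f -> measurable_fun B H -> (forall x, B x -> 0 <= H x) ->
  {ae mu, forall x, B x -> `|f x - a%:E| <= H x} ->
  \int[mu]_(x in B) H x <= c%:E * mu B ->
  exists2 m : R, average mu B f = m%:E & (`|m - a| <= c)%R.
Proof.
move=> mf mH H0 fH Hc.
have Bfin : mu B \is a fin_num by rewrite ge0_fin_numE// ltW.
have mfa : measurable_fun B (fun x => f x - a%:E) by exact: emeasurable_funB.
have le_c : \int[mu]_(x in B) `|f x - a%:E| <= c%:E * mu B.
  apply: le_trans Hc; apply: ae_ge0_le_integral => //.
  exact: measurableT_comp.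
have ifa : mu.-integrable B (fun x => f x - a%:E).
  apply/integrableP; split => //; apply: le_lt_trans le_c _.
  by rewrite ltey_eq fin_numM.
have ia : mu.-integrable B (cst a%:E).
  apply/integrableP; split => //.
  rewrite (eq_integral (cst `|a|%:E)); last by [].
  by rewrite integral_cst// ltey_eq fin_numM.
have fE : f = (fun x => (f x - a%:E) + a%:E).
  by apply/funext => x; rewrite subeK.
have intE : \int[mu]_(x in B) f x = \int[mu]_(x in B) (f x - a%:E) + a%:E * mu B.
  by rewrite [in LHS]fE integralD//= integral_cst.
have Ifin : \int[mu]_(x in B) (f x - a%:E) \is a fin_num by exact: integrable_fin_num.
have Ile : `|\int[mu]_(x in B) (f x - a%:E)| <= c%:E * mu B.
  by apply: le_trans le_c; apply: le_abse_integral.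
rewrite /average intE.
move: Ile B_gt0; rewrite -(fineK Bfin) -(fineK Ifin) inver lte_fin.
set I := fine _; set m := fine _ => Ile m0.
rewrite gt_eqF// -EFinM; eexists; first reflexivity.
move: Ile; rewrite abse_EFin -EFinM lee_fin => Ile.
rewrite mulrDr mulrCA mulVf ?gt_eqF// mulr1 addrK normrM ger0_norm ?invr_ge0 ?(ltW m0)//.
by rewrite mulrC ler_pdivrMr.
Qed.
End averages.

(** * The three regimes of the geometric sum *)

Section embeddings.
Context d (R : realType) (X : metricMeasurableType d R).
Variable mu : {measure set X -> \bar R}.
Variable (B : set X).
Hypotheses (mB : d.-measurable B) (B_gt0 : 0 < mu B) (B_fin : mu B < +oo).
Variable u : X -> \bar R.
Hypothesis meas_u : measurable_fun B u.

(** What the chaining argument provides on the ball [B]: the level [j] of a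
    point controls the deviation of [u] from [a], and large levels are rare,
    since [(2 `^ p) ^+ j] is dominated by a function of bounded average. *)
Definition dyadic_control (h : X -> \bar R) (p lam beta a : R) : Prop :=
  [/\ measurable_fun B h, forall x, 0 <= h x,
      \int[mu]_(x in B) h x <= 2%:E * mu B &
      {ae mu, forall x, B x -> u x \is a fin_num /\
        exists2 j : nat, ((2 `^ p) ^+ j)%:E <= (2 `^ p)%:E * h x &
          (`|fine (u x) - a| <= beta * (1 + \sum_(i < j) lam ^+ i))%R}].

Variables (h : X -> \bar R) (p lam beta a : R).
Hypotheses (p0 : (0 < p)%R) (beta0 : (0 < beta)%R).
Hypothesis ctrl : dyadic_control h p lam beta a.

Lemma integral_scaled_weight (c : R) : (0 <= c)%R ->
  [/\ measurable_fun B (fun x => c%:E * h x), (forall x, B x -> 0 <= c%:E * h x) &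
  \int[mu]_(x in B) (c%:E * h x) <= (c * 2)%:E * mu B].
Proof.
have [mh h0 ih _] := ctrl; move=> c0; split.
- exact: measurable_funeM.
- by move=> x _; rewrite mule_ge0.
by rewrite ge0_integralZl_EFin// EFinM -muleA lee_wpmul2l.
Qed.

Lemma fin_dist (x : X) (m : R) : u x \is a fin_num -> `|u x - m%:E| = `|fine (u x) - m|%:E.
Proof. by move=> ux; rewrite -{1}(fineK ux). Qed.

Lemma measurable_dist (m : R) : measurable_fun B (fun x => `|u x - m%:E|).
Proof. by apply: measurableT_comp => //; exact: emeasurable_funB. Qed.

(** For [1 < lam] the geometric sum is of order [lam ^+ j], and the exponent
    [P] turns [lam ^+ j] into [(2 `^ p) ^+ j]. *)
Lemma average_dist_poweR_le (P : R) : (1 < lam)%R -> (0 < P)%R -> (lam `^ P = 2 `^ p)%R ->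
  average mu B (fun x => `|u x - a%:E| `^ P) <=
  ((beta * (1 + (lam - 1)^-1)) `^ P * 2 `^ p * 2)%:E.
Proof.
move=> lam1 P0 lamP.
set c := ((beta * (1 + (lam - 1)^-1)) `^ P)%R.
have c0 : (0 <= c)%R by exact: powR_ge0.
have [|mH H0 iH] := integral_scaled_weight (c := (c * 2 `^ p)%R).
  by rewrite mulr_ge0// powR_ge0.
apply: (average_le mB B_gt0 B_fin _ mH _ H0 _ iH).
- exact: (measurableT_comp (measurable_poweR _) (measurable_dist a)).
- by move=> x _; exact: poweR_ge0.
have [_ _ _] := ctrl; apply: filterS => x + Bx => /(_ Bx)[ux [j jh uj]].
rewrite fin_dist// poweR_EFin EFinM -muleA.
apply: (@le_trans _ _ (c%:E * ((2 `^ p) ^+ j)%:E)); last first.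
  by rewrite lee_wpmul2l.
have l0 : (0 <= 1 + (lam - 1)^-1)%R by rewrite addr_ge0// invr_ge0 subr_ge0 ltW.
have lam0 : (0 <= lam)%R by rewrite (le_trans _ (ltW lam1)).
rewrite -EFinM lee_fin -lamP -(powR_exprAC _ _ lam0) /c -powRM ?exprn_ge0//; last first.
  by rewrite mulr_ge0// ltW.
apply: ge0_ler_powR; rewrite ?nnegrE ?(ltW P0)//.
  by rewrite !mulr_ge0 ?exprn_ge0// ltW.
apply: (le_trans uj); rewrite -mulrA ler_wpM2l ?(ltW beta0)//.
exact: geometric_ge1.
Qed.

(** For [lam < 1] the geometric sum is bounded, so [u] is within a constant
    of [a], and so is its average. *)
Lemma dist_average_le : (0 <= lam < 1)%R -> exists2 m : R, average mu B u = m%:E &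
  {ae mu, forall x, B x -> `|u x - m%:E| <= (2 * (beta * (1 + (1 - lam)^-1)))%:E}.
Proof.
move=> lam01; set c := (beta * _)%R.
have uc : {ae mu, forall x, B x -> `|u x - a%:E| <= c%:E}.
  have [_ _ _] := ctrl; apply: filterS => x + Bx => /(_ Bx)[ux [j _ uj]].
  rewrite fin_dist// lee_fin (le_trans uj)//.
  by rewrite ler_wpM2l ?(ltW beta0)// lerD2l; exact: geometric_le1.
have c0 : (0 <= c)%R.
  case/andP: lam01 => _ l1.
  by rewrite mulr_ge0 ?(ltW beta0)// addr_ge0// invr_ge0 subr_ge0 ltW.
have [||m mE ma] := average_near (c := c) mB B_gt0 B_fin meas_u (measurable_cst c%:E) _ uc.
- by move=> x _; rewrite lee_fin.
- by rewrite integral_cst.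
exists m => //; move: uc; have [_ _ _ H] := ctrl.
apply: filterS2 H => x H uc Bx; have [ux _] := H Bx; move: (uc Bx).
rewrite !fin_dist// !lee_fin => ua.
rewrite -(subrKA a); apply: (le_trans (ler_normD _ _)).
by rewrite mulr2n mulrDl !mul1r lerD// distrC.
Qed.

(** For [lam = 1] the geometric sum is [j], and the exponential with rate
    [p * ln 2 / beta] turns [beta * j.+1] into [(2 `^ p) ^+ j.+1]. Replacing [a] by
    the average of [u] costs a constant factor, because
    [j.+1 * (p * ln 2) <= (2 `^ p) ^+ j.+1] bounds the average of [`|u - a|]. *)
Lemma average_exp_dist_le : lam = 1%R -> exists2 m : R, average mu B u = m%:E &
  average mu B (fun x => expeR ((p * ln 2 / beta)%:E * `|u x - m%:E|)) <=
  ((2 `^ p) ^+ 2 * expR ((2 `^ p) ^+ 2 * 2) * 2)%:E.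
Proof.
move=> lam1.
set D := ((2 `^ p) ^+ 2)%R.
have D0 : (0 < D)%R by rewrite exprn_gt0// powR_gt0.
have ln2 : (0 < ln (2:R))%R by rewrite ln_gt0// ltr1n.
have pln : (0 < p * ln 2)%R by rewrite mulr_gt0.
have exp2 j : expR (p * ln 2 * j%:R) = ((2 `^ p) ^+ j)%R.
  by rewrite /powR pnatr_eq0/= expRM_natr.
have uj : {ae mu, forall x, B x -> u x \is a fin_num /\
   exists2 j : nat, ((2 `^ p) ^+ j.+1)%:E <= D%:E * h x &
     (`|fine (u x) - a| <= beta * j.+1%:R)%R}.
  have [_ _ _] := ctrl; apply: filterS => x + Bx => /(_ Bx)[ux [j jh uj]].
  split => //; exists j.
    by rewrite exprS EFinM /D expr2 EFinM -muleA lee_wpmul2l// lee_fin powR_ge0.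
  apply: (le_trans uj); rewrite lam1.
  by under eq_bigr do rewrite expr1n; rewrite sumr_const card_ord nat1r.
have uc : {ae mu, forall x, B x -> `|u x - a%:E| <= (beta / (p * ln 2) * D)%:E * h x}.
  move: uj; apply: filterS => x + Bx => /(_ Bx)[ux [j jh uj]].
  rewrite fin_dist// EFinM -muleA.
  apply: (@le_trans _ _ ((beta / (p * ln 2))%:E * ((2 `^ p) ^+ j.+1)%:E)); last first.
    by rewrite lee_wpmul2l// lee_fin divr_ge0// ltW.
  rewrite -EFinM lee_fin (le_trans uj)// -mulrA ler_wpM2l ?(ltW beta0)//.
  rewrite ler_pdivlMl// -exp2.
  by apply: le_trans (expR_ge1Dx _); rewrite lerDr.
have [|mH H0 iH] := integral_scaled_weight (c := (beta / (p * ln 2) * D)%R).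
  by rewrite mulr_ge0 ?divr_ge0 ?(ltW D0) ?(ltW pln) ?(ltW beta0).
have [m mE ma] := average_near mB B_gt0 B_fin meas_u mH H0 uc iH.
exists m => //.
have [|mH' H0' iH'] := integral_scaled_weight (c := (D * expR (D * 2))%R).
  by rewrite mulr_ge0 ?expR_ge0// ltW.
apply: (average_le mB B_gt0 B_fin _ mH' _ H0' _ iH').
- apply: (measurableT_comp (@measurable_expeR R)).
  by apply: measurable_funeM; exact: measurable_dist.
- by move=> x _; exact: expeR_ge0.
move: uj; apply: filterS => x + Bx => /(_ Bx)[ux [j jh uj]].
rewrite fin_dist// -EFinM/=.
apply: (@le_trans _ _ (expR (D * 2) * (2 `^ p) ^+ j.+1)%:E); last first.
  by rewrite (mulrC D (expR _)) 2!EFinM -muleA lee_wpmul2l// lee_fin expR_ge0.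
rewrite lee_fin -exp2 -expRD ler_expR.
have um : (`|fine (u x) - m| <= beta / (p * ln 2) * D * 2 + beta * j.+1%:R)%R.
  rewrite -(subrKA a); apply: (le_trans (ler_normD _ _)).
  by rewrite addrC lerD// distrC.
apply: (le_trans (ler_wpM2l _ um)).
  by rewrite divr_ge0// ltW.
rewrite le_eqVlt; apply/orP; left; apply/eqP; field.
by rewrite !gt_eqF.
Qed.

End embeddings.

(** * Constants *)

Section constants.
Context (R : realType).
Variables (s p Q : R).
Hypotheses (s0 : (0 < s)%R) (p0 : (0 < p)%R) (Q0 : (0 < Q)%R).

Definition chain_growth : R := (2 * chain_ratio p Q `^ s)%R.

(** The height [T] of the levels is chosen proportional to
    [kappa * r0 `^ (- s)], with the factor [(1 - theta) `^ (- (Q / p))] that makes the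
    first step of a chain short enough; [4 * 4 `^ s] comes from level [0]. *)
Definition chain_const : R :=
  (4 * 4 `^ s * (1 - chain_ratio p Q) `^ (- (Q / p)))%R.

(** The [b]-dependence reflects scaling: multiplying the measure by a constant
    multiplies the norm of the gradient by its power [p^-1], so the natural rate
    is a multiple of [b `^ p^-1]. The last factor compensates
    the factor [b `^ Q^-1] that accompanies the rate in the exponent. *)
Definition trudinger_rate (b : R) : R :=
  (p * ln 2 / (2 * chain_const) * b `^ p^-1 / b `^ Q^-1)%R.

Lemma chain_growthE : chain_growth = (2 `^ (1 - s * p / Q))%R.
Proof.
rewrite /chain_growth /chain_ratio -powRrM -{1}(powRr1 (ler0n R 2)) -powRD.
  by congr (powR _ _); ring.
by rewrite pnatr_eq0 implybT.
Qed.

Lemma chain_const_gt0 : (0 < chain_const)%R.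
Proof.
have /andP[_ h] := chain_ratio_bound p0 Q0.
by rewrite /chain_const !mulr_gt0 ?powR_gt0// subr_gt0.
Qed.

Lemma chain_growth_gt1 : (s * p < Q)%R -> (1 < chain_growth)%R.
Proof.
move=> spQ; rewrite chain_growthE.
by rewrite powR2_gt1// subr_gt0 ltr_pdivrMr// mul1r.
Qed.

Lemma chain_growth_eq1 : (s * p = Q)%R -> chain_growth = 1%R.
Proof. by move=> spQ; rewrite chain_growthE spQ divff ?gt_eqF// subrr powRr0. Qed.

Lemma chain_growth_lt1 : (Q < s * p)%R -> (0 <= chain_growth < 1)%R.
Proof.
move=> spQ; rewrite chain_growthE powR_ge0/= -opprB powRN invf_lt1 ?powR_gt0//.
by rewrite powR2_gt1// subr_gt0 ltr_pdivlMr// mul1r.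
Qed.

Lemma sobolev_exponent_gt0 : (s * p < Q)%R -> (0 < Q * p / (Q - s * p))%R.
Proof. by move=> spQ; rewrite divr_gt0 ?mulr_gt0// subr_gt0. Qed.

Lemma chain_growth_powR : (s * p < Q)%R ->
  (chain_growth `^ (Q * p / (Q - s * p)) = 2 `^ p)%R.
Proof.
move=> spQ; rewrite chain_growthE -powRrM; congr (powR _ _); field.
by rewrite !gt_eqF// subr_gt0.
Qed.

End constants.

(** * The embeddings on a ball *)

Section assembly.
Context d (R : realType) (X : metricMeasurableType d R).
Variable mu : {measure set X -> \bar R}.
Variables (s p q Q : R) (x0 : X) (r0 b : R) (u : X -> \bar R).
Hypotheses (s0 : (0 < s)%R) (p0 : (0 < p)%R) (q0 : (0 < q)%R).
Hypotheses (qp : (q <= p)%R) (Q0 : (0 < Q)%R).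
Let B0 := ball x0 r0.
Let twoB0 := ball x0 (2 * r0)%R.
Hypotheses (mms : metric_measure_space mu) (r00 : (0 < r0)%R) (b0 : (0 < b)%R).
Hypothesis lower : forall (x : X) (r : R), (0 < r)%R -> ball x r `<=` twoB0 ->
       (b * r `^ Q)%:E <= mu (ball x r).
Hypothesis ux0 : twoB0 = [set x0] -> u x0 \is a fin_num.

(** The free parameter [kappa] is the size of the oscillation. The chaining argument
    needs a strict inequality, so that it applies to every [kappa] above
    the critical value and also when the gradient vanishes. *)
Lemma control_of_energy (g : int -> X -> \bar R) (kappa : R) :
  fractional_gradient mu s twoB0 u g -> (0 < kappa)%R ->
  (\int[mu]_(x in twoB0) lp_gradient p g x) * (r0 `^ (s * p))%:E <
    (b * r0 `^ Q * kappa `^ p)%:E ->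
  exists a h, dyadic_control mu B0 u h p (chain_growth s p Q)
                (chain_const s p Q * kappa) a.
Proof.
move=> gradg k0 HA.
set theta := chain_ratio p Q.
have /andP[th0 th1] : (0 < theta < 1)%R by exact: chain_ratio_bound.
have th10 : (0 < 1 - theta)%R by rewrite subr_gt0.
pose T := (kappa * r0 `^ (- s) * (1 - theta) `^ (- (Q / p)))%R.
have T0 : (0 < T)%R by rewrite /T !mulr_gt0 ?powR_gt0.
have HT : (b * (r0 * (1 - theta)) `^ Q * T `^ p =
   b * r0 `^ Q * kappa `^ p / (r0 `^ (s * p)))%R.
  rewrite /T !powRM ?mulr_ge0 ?powR_ge0 ?(ltW r00) ?(ltW k0) ?(ltW th10)//.
  rewrite -!powRrM !mulNr divfK ?gt_eqF// !powRN.
  by field; rewrite !gt_eqF ?powR_gt0.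
have [|mh ih [a Ha]] := oscillation mms r00 b0 s0 p0 Q0 T0 lower ux0 gradg.
  by rewrite HT EFinM lte_pdivlMr ?powR_gt0.
exists a, (weight p T g); split => //; first by move=> x; exact: weight_ge0.
have -> // : (chain_const s p Q * kappa = 4 * 4 `^ s * T * r0 `^ s)%R.
rewrite /chain_const -/theta /T (powRN r0); field.
by rewrite gt_eqF ?powR_gt0.
Qed.

Lemma B0_pos : 0 < mu B0. Proof. by have [_ _ /(_ x0 r0 r00)[]] := mms. Qed.
Lemma B0_fin : mu B0 < +oo. Proof. by have [_ _ /(_ x0 r0 r00)[]] := mms. Qed.
Lemma twoB0_pos : 0 < mu twoB0.
Proof. by have [_ _ h] := mms; case: (h x0 (2 * r0)%R (mulr_gt0 (ltr0Sn R 1) r00)). Qed.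
Lemma twoB0_fin : mu twoB0 < +oo.
Proof. by have [_ _ h] := mms; case: (h x0 (2 * r0)%R (mulr_gt0 (ltr0Sn R 1) r00)). Qed.
Lemma B0_sub : B0 `<=` twoB0.
Proof. by apply: le_ball; rewrite ler_peMl ?ler1n// ltW. Qed.
Lemma mB0 : d.-measurable B0. Proof. exact: measurable_mball mms. Qed.
Lemma mtwoB0 : d.-measurable twoB0. Proof. exact: measurable_mball mms. Qed.

(** The right-hand side of the first and third estimates, up to the constant. *)
Definition besov_bound (g : int -> X -> \bar R) : \bar R :=
  (mu twoB0 / (b * r0 `^ Q)%:E) `^ p^-1 * (r0 `^ s)%:E *
      (\esum_(j in [set: int])
         (average mu twoB0 (fun x => g j x `^ p)) `^ (q / p)) `^ q^-1.

Lemma besov_bound_ge0 g : 0 <= besov_bound g.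
Proof. by rewrite /besov_bound !mule_ge0 ?poweR_ge0// lee_fin powR_ge0. Qed.

Lemma energy_le_besov_bound g (k kappa : R) :
  fractional_gradient mu s twoB0 u g ->
  besov_bound g = k%:E -> (k < kappa)%R ->
  (\int[mu]_(x in twoB0) lp_gradient p g x) * (r0 `^ (s * p))%:E <
    (b * r0 `^ Q * kappa `^ p)%:E.
Proof.
move=> gradg gk kk.
have k0 : (0 <= k)%R by rewrite -lee_fin -gk besov_bound_ge0.
have br0 : (0 < b * r0 `^ Q)%R by rewrite mulr_gt0// powR_gt0.
have mfin : mu twoB0 \is a fin_num by rewrite ge0_fin_numE ?twoB0_fin// ltW// twoB0_pos.
apply: (@le_lt_trans _ _ (b * r0 `^ Q * k `^ p)%:E); last first.
  by rewrite lte_fin ltr_pM2l// gt0_ltr_powR// nnegrE// (le_trans k0)// ltW.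
have := integral_lp_gradient_le_average mtwoB0 gradg q0 qp.
rewrite twoB0_pos twoB0_fin => /(_ isT).
move=> /(lee_wpmul2r (x := (r0 `^ (s * p))%:E)); rewrite lee_fin powR_ge0 => /(_ isT).
move=> /le_trans; apply.
rewrite (_ : (b * r0 `^ Q * k `^ p)%:E = (b * r0 `^ Q)%:E * besov_bound g `^ p);
  last by rewrite gk poweR_EFin -EFinM.
rewrite /besov_bound.
move ME : (mu twoB0 / (b * r0 `^ Q)%:E) => M.
have M0 : 0 <= M.
  by rewrite -ME mule_ge0 ?inve_ge0 ?lee_fin ?(ltW br0)// ltW ?twoB0_pos.
set K' := (_ `^ q^-1).
rewrite poweRM ?mule_ge0 ?poweR_ge0 ?lee_fin ?powR_ge0//.
rewrite poweRM ?poweR_ge0 ?lee_fin ?powR_ge0//.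
rewrite -poweRrM mulVf ?gt_eqF// poweRe1// poweR_EFin -powRrM.
have -> : mu twoB0 = (b * r0 `^ Q)%:E * M.
  by rewrite -ME muleCA inver gt_eqF// -EFinM mulfV ?gt_eqF// mule1.
by rewrite -!muleA (muleC (K' `^ p)).
Qed.

Hypothesis meas_u : measurable_fun twoB0 u.

Lemma measurable_B0 : measurable_fun B0 u.
Proof. exact: measurable_funS mtwoB0 B0_sub meas_u. Qed.

Lemma besov_finite_gradient : hajlasz_besov mu s p q twoB0 u ->
  exists g, fractional_gradient mu s twoB0 u g /\
    \int[mu]_(x in twoB0) lp_gradient p g x < +oo.
Proof.
move=> [_ /ereal_inf_lt[_ [g gradg <-] goo]]; exists g; split => //.
apply: le_lt_trans (integral_lp_gradient_le_norm mtwoB0 gradg q0 qp) _.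
exact: poweR_lty.
Qed.

Lemma control_finite_energy (g : int -> X -> \bar R) :
  fractional_gradient mu s twoB0 u g ->
  \int[mu]_(x in twoB0) lp_gradient p g x < +oo ->
  exists kappa a h, (0 < kappa)%R /\
   dyadic_control mu B0 u h p (chain_growth s p Q) (chain_const s p Q * kappa) a.
Proof.
move=> gradg Aoo; set A := integral _ _ _ in Aoo.
have A0 : 0 <= A by apply: integral_ge0 => x _; exact: lp_gradient_ge0.
have Afin : A \is a fin_num by rewrite ge0_fin_numE.
have br0 : (0 < b * r0 `^ Q)%R by rewrite mulr_gt0// powR_gt0.
pose e := (fine A * r0 `^ (s * p) / (b * r0 `^ Q) + 1)%R.
have e0 : (0 < e)%R.
  by rewrite ltr_wpDl// !mulr_ge0 ?invr_ge0 ?powR_ge0 ?fine_ge0// ltW.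
have [|a [h H]] := control_of_energy gradg (powR_gt0 p^-1 e0).
  rewrite -/A -powRrM mulVf ?gt_eqF// powRr1 ?(ltW e0)// -(fineK Afin) -EFinM lte_fin.
  by rewrite -ltr_pdivrMl// mulrC ltrDl.
by exists (e `^ p^-1)%R, a, h; split => //; exact: powR_gt0.
Qed.

(** A ball has finite measure, so adding the constant [a] does not destroy
    integrability. *)
Lemma in_Lp_of_average (P a c : R) : (0 < P)%R ->
  average mu B0 (fun x => `|u x - a%:E| `^ P) <= c%:E -> in_Lp mu P B0 u.
Proof.
move=> P0 avg; split; first exact: measurable_B0.
have Bfin : mu B0 \is a fin_num by rewrite ge0_fin_numE ?B0_fin// ltW// B0_pos.
have mdist := measurable_dist measurable_B0 a.
have mpow : measurable_fun B0 (fun x => `|u x - a%:E| `^ P).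
  exact: (measurableT_comp (measurable_poweR _) mdist).
have ioo : \int[mu]_(x in B0) `|u x - a%:E| `^ P < +oo.
  have -> : \int[mu]_(x in B0) `|u x - a%:E| `^ P =
     mu B0 * average mu B0 (fun x => `|u x - a%:E| `^ P).
    by rewrite /average muleA divee ?mul1e// gt_eqF// B0_pos.
  apply: (@le_lt_trans _ _ (mu B0 * c%:E)).
    by rewrite lee_wpmul2l// ltW// B0_pos.
  by rewrite ltey_eq fin_numM.
apply: (@lty_poweRy _ _ P); first by rewrite gt_eqF.
rewrite poweR_Lnorm ?gt_eqF//.
have -> : \int[mu]_x `|(u \_ B0) x| `^ P = \int[mu]_(x in B0) `|u x| `^ P.
  rewrite [RHS]integral_mkcond; apply: eq_integral => x _ /=.
  by rewrite /patch; case: ifPn => // _; rewrite abse0 poweR0r// gt_eqF.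
have pw x : `|u x| `^ P <= (2 `^ P)%:E * (`|u x - a%:E| `^ P + (`|a| `^ P)%:E).
  have yP : +oo `^ P = +oo :> \bar R by rewrite poweRyr// gt_eqF.
  case: (u x) => [t||]; last 2 first.
  - have -> : `|+oo - a%:E| = +oo by [].
    by rewrite yP addye// gt0_muley ?leey// lte_fin powR_gt0.
  - have -> : `|-oo - a%:E| = +oo by [].
    by rewrite yP addye// gt0_muley ?leey// lte_fin powR_gt0.
  rewrite /= lee_fin; pose m := Num.max `|t - a|%R `|a|%R.
  have m0 : (0 <= m)%R by rewrite le_max normr_ge0.
  apply: (@le_trans _ _ ((2 * m) `^ P)%R).
    apply: ge0_ler_powR; rewrite ?nnegrE ?(ltW P0) ?mulr_ge0//.
    rewrite -{1}(subrK a t); apply: (le_trans (ler_normD _ _)).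
    by rewrite mulr2n mulrDl !mul1r lerD// le_max lexx ?orbT.
  rewrite powRM// ler_wpM2l ?powR_ge0// /m maxEle.
  by case: ifPn => _; rewrite ?lerDl ?lerDr powR_ge0.
have mR : measurable_fun B0 (fun x => `|u x - a%:E| `^ P + (`|a| `^ P)%:E).
  exact: emeasurable_funD.
have mA : measurable_fun B0 (fun x => (2 `^ P)%:E * (`|u x - a%:E| `^ P + (`|a| `^ P)%:E)).
  exact: measurable_funeM.
apply: (@le_lt_trans _ _ (\int[mu]_(x in B0)
  ((2 `^ P)%:E * (`|u x - a%:E| `^ P + (`|a| `^ P)%:E)))).
  apply: ge0_le_integral => //; first exact: mB0.
    by move=> x _; exact: poweR_ge0.
  apply: (measurableT_comp (measurable_poweR _)).
  by apply: measurableT_comp => //; exact: measurable_B0.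
rewrite ge0_integralZl_EFin ?powR_ge0//; last 2 first.
- exact: mB0.
- by move=> x _; rewrite adde_ge0// ?poweR_ge0// lee_fin powR_ge0.
rewrite ge0_integralD//; first last.
- by move=> x _; exact: poweR_ge0.
- exact: mB0.
rewrite [X in _ + X](integral_cst mu mB0).
by rewrite lte_mul_pinfty ?lee_fin ?powR_ge0// lte_add_pinfty// ltey_eq fin_numM.
Qed.

(** Membership of [u] in the space only provides some gradient of finite
    norm, whereas the estimate concerns the given [g], whose norm may be infinite;
    the two halves therefore use different gradients. *)
Lemma sobolev_case (g : int -> X -> \bar R) : (s * p < Q)%R ->
  let P := (Q * p / (Q - s * p))%R in
  fractional_gradient mu s twoB0 u g -> hajlasz_besov mu s p q twoB0 u ->
  in_Lp mu P B0 u /\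
  ereal_inf [set (average mu B0 (fun x => `|u x - a%:E| `^ P)) `^ P^-1 | a in [set: R]]
    <= (chain_const s p Q * (1 + `|(chain_growth s p Q - 1)^-1|) *
         (2 `^ p * 2) `^ P^-1)%:E * besov_bound g.
Proof.
move=> spQ P gradg hb.
have P0 : (0 < P)%R by exact: sobolev_exponent_gt0.
have lam1 := chain_growth_gt1 Q0 spQ.
have lamP : (chain_growth s p Q `^ P = 2 `^ p)%R by exact: chain_growth_powR.
set L := chain_const s p Q; have L0 : (0 < L)%R by exact: chain_const_gt0.
set lam := chain_growth s p Q in lam1 lamP *.
have bound kappa a h : (0 < kappa)%R -> dyadic_control mu B0 u h p lam (L * kappa) a ->
  average mu B0 (fun x => `|u x - a%:E| `^ P) <=
  ((L * kappa * (1 + (lam - 1)^-1)) `^ P * 2 `^ p * 2)%:E.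
  move=> k0 ctrl.
  exact: (average_dist_poweR_le mB0 B0_pos B0_fin measurable_B0 (mulr_gt0 L0 k0) ctrl).
split.
  have [g' [gradg' Aoo]] := besov_finite_gradient hb.
  have [kappa [a [h [k0 ctrl]]]] := control_finite_energy gradg' Aoo.
  exact: in_Lp_of_average P0 (bound _ _ _ k0 ctrl).
set C := (L * _ * _)%R.
have C0 : (0 < C)%R.
  rewrite /C mulr_gt0//; first by rewrite mulr_gt0// ltr_pwDl.
have := besov_bound_ge0 g; case kE : (besov_bound g) => [k||] // k0; last first.
  by rewrite gt0_muley ?leey// lte_fin.
(* The chaining argument applies to kappa > k only, so an error e is
   allowed and kappa is chosen with C * kappa = C * k + e. *)
apply/lee_addgt0Pr => e e0; rewrite -EFinM -EFinD.
pose kappa := (k + e / C)%R.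
have kk : (k < kappa)%R by rewrite ltrDl divr_gt0.
have kap0 : (0 < kappa)%R by exact: le_lt_trans kk.
have [a [h ctrl]] := control_of_energy gradg kap0 (energy_le_besov_bound gradg kE kk).
apply: (@le_trans _ _ ((average mu B0 (fun x => `|u x - a%:E| `^ P)) `^ P^-1)).
  by apply: ereal_inf_lbound; exists a.
have lam10 : (0 <= (lam - 1)^-1)%R by rewrite invr_ge0 subr_ge0 ltW.
have X0 : (0 <= L * kappa * (1 + (lam - 1)^-1))%R.
  by rewrite mulr_ge0 ?addr_ge0// mulr_ge0 ?(ltW L0) ?(ltW kap0).
have avg0 : 0 <= average mu B0 (fun x => `|u x - a%:E| `^ P).
  apply: mule_ge0; first by rewrite inve_ge0 ltW// B0_pos.
  by apply: integral_ge0 => x _; exact: poweR_ge0.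
have := gt0_ler_poweR (r := P^-1) _ _ _ (bound _ _ _ kap0 ctrl).
rewrite invr_ge0 (ltW P0) !in_itv/= !leey avg0 lee_fin !mulr_ge0 ?powR_ge0//.
move=> /(_ isT isT isT) /le_trans; apply.
rewrite lee_fin -[X in (X `^ _)%R]mulrA powRM ?powR_ge0 ?mulr_ge0 ?powR_ge0//.
rewrite -powRrM mulfV ?gt_eqF// powRr1//.
rewrite le_eqVlt; apply/orP; left; apply/eqP.
rewrite [RHS](_ : _ = C * kappa)%R; last by rewrite /kappa mulrDr mulrCA mulfV ?mulr1// gt_eqF.
by rewrite /C ger0_norm//; ring.
Qed.

Lemma morrey_case (g : int -> X -> \bar R) : (Q < s * p)%R ->
  fractional_gradient mu s twoB0 u g ->
  'N[mu]_+oo[(fun x => u x - average mu B0 u) \_ B0] <=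
  (chain_const s p Q * (2 * (1 + `|(1 - chain_growth s p Q)^-1|)))%:E * besov_bound g.
Proof.
move=> spQ gradg.
have lam01 := chain_growth_lt1 Q0 spQ; have /andP[_ lam1] := lam01.
set L := chain_const s p Q; have L0 : (0 < L)%R by exact: chain_const_gt0.
set lam := chain_growth s p Q in lam01 lam1 *.
set C := (L * _)%R.
have C0 : (0 < C)%R by rewrite /C mulr_gt0// mulr_gt0// ltr_pwDl.
have := besov_bound_ge0 g; case kE : (besov_bound g) => [k||] // k0; last first.
  by rewrite gt0_muley ?leey// lte_fin.
(* The chaining argument applies to kappa > k only, so an error e is
   allowed and kappa is chosen with C * kappa = C * k + e. *)
apply/lee_addgt0Pr => e e0; rewrite -EFinM -EFinD.
pose kappa := (k + e / C)%R.
have kk : (k < kappa)%R by rewrite ltrDl divr_gt0.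
have kap0 : (0 < kappa)%R by exact: le_lt_trans kk.
have [a [h ctrl]] := control_of_energy gradg kap0 (energy_le_besov_bound gradg kE kk).
have [m mE um] := dist_average_le mB0 B0_pos B0_fin measurable_B0 (mulr_gt0 L0 kap0) ctrl lam01.
have lam10 : (0 <= (1 - lam)^-1)%R by rewrite invr_ge0 subr_ge0 ltW.
have CE : (2 * (L * kappa * (1 + (1 - lam)^-1)) = C * k + e)%R.
  rewrite [RHS](_ : _ = C * kappa)%R; last by rewrite /kappa mulrDr mulrCA mulfV ?mulr1// gt_eqF.
  by rewrite /C ger0_norm//; ring.
rewrite CE in um.
have Ce0 : (0 <= C * k + e)%R by rewrite addr_ge0 ?(ltW e0)// mulr_ge0 ?(ltW C0).
rewrite unlock; case: ifPn => _; last by rewrite lee_fin.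
apply/ess_supP; move: um; apply: filterS => x /= um.
rewrite /patch; case: ifPn => [/set_mem Bx|_]; first by rewrite mE um.
by rewrite abse0 lee_fin.
Qed.

Lemma average_eq_const (a : R) :
  {ae mu, forall x, B0 x -> u x = a%:E} -> average mu B0 u = a%:E.
Proof.
move=> ua.
have [|||m -> ma] := average_near (c := 0%R) (a := a) mB0 B0_pos B0_fin measurable_B0
  (@measurable_cst _ _ _ _ _ (0 : \bar R)).
- by move=> x _.
- by move: ua; apply: filterS => x + Bx => /(_ Bx) ->; rewrite subee// abse0.
- by rewrite integral_cst ?mul0e//; exact: mB0.
by congr EFin; apply/eqP; rewrite -subr_eq0 -normr_le0.
Qed.

Lemma average_exp0 (f : X -> \bar R) (c : R) : (1 <= c)%R ->
  measurable_fun B0 f ->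
  {ae mu, forall x, B0 x -> f x = 0} -> average mu B0 (fun x => expeR (f x)) <= c%:E.
Proof.
move=> c1 mf f0.
apply: (average_le (H := cst 1) mB0 B0_pos B0_fin) => //.
- exact: (measurableT_comp (@measurable_expeR R)).
- by move=> x _; exact: expeR_ge0.
- by move: f0; apply: filterS => x + Bx => /(_ Bx) ->; rewrite expeR0.
- rewrite integral_cst; last exact: mB0.
  by rewrite lee_wpmul2r ?lee_fin// ltW// B0_pos.
Qed.

(** The critical exponential estimate divides by the norm of the gradient, so the
    case of a vanishing gradient must be settled exactly. *)
Lemma zero_energy_const (g : int -> X -> \bar R) :
  fractional_gradient mu s twoB0 u g ->
  \int[mu]_(x in twoB0) lp_gradient p g x = 0 ->
  exists a : R, {ae mu, forall x, B0 x -> u x = a%:E}.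
Proof.
move=> gradg A0.
have x02 : twoB0 x0 by apply: ballxx; rewrite mulr_gt0.
have [|F [mF F0 Ffin Fgrad _]] := full_measure_gradient p0 mms (open_mball _ _) x02 ux0 gradg.
  by rewrite A0.
have mG := @measurable_lp_gradient _ _ _ mu s p _ u g gradg.
have [N [mN N0 NG]] : {ae mu, forall x, twoB0 x -> lp_gradient p g x = 0}.
  apply/(ae_eq_integral_abs _ mtwoB0 mG).
  rewrite -[RHS]A0; apply: eq_integral => x _.
  by rewrite gee0_abs//; exact: lp_gradient_ge0.
pose M := (twoB0 `\` F) `|` N.
have mM : d.-measurable M by apply: measurableU => //; apply: measurableD => //; exact: mtwoB0.
have M0 : mu M = 0 by rewrite /M measureU0//; apply: measurableD => //; exact: mtwoB0.
have good x : B0 x -> ~ M x -> F x /\ lp_gradient p g x = 0.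
  move=> /B0_sub Bx Mx; split.
    by apply: contrapT => Fx; apply: Mx; left.
  by apply: contrapT => Gx; apply: Mx; right; apply: NG => /= /(_ Bx).
have [y [By My]] : exists y, B0 y /\ ~ M y.
  apply: contrapT => /forallNP h; have := B0_pos; rewrite ltNge -M0 => /negP; apply.
  apply: le_measure; rewrite ?inE//; first exact: mB0.
  by move=> x Bx; apply: contrapT => Mx; apply: (h x).
have [Fy Gy] := good y By My.
exists (fine (u y)); exists M; split => // x /= /not_implyP[Bx ux].
apply: contrapT => Mx; apply: ux.
have [Fx Gx] := good x Bx Mx.
have [_ ufx _] := Ffin x Fx; rewrite -(fineK ufx); congr EFin.
have := Fgrad x y Fx Fy; rewrite Gx Gy /= powR0 ?invr_neq0 ?gt_eqF// addr0 mulr0.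
by rewrite normr_le0 subr_eq0 => /eqP.
Qed.

(** An infinite norm makes the exponent vanish, as does a vanishing one, for
    then [u] is constant almost everywhere on the ball; otherwise [kappa] is taken to be
    twice the critical value, for the strict inequality that chaining needs. *)
Lemma trudinger_case (g : int -> X -> \bar R) : (s * p = Q)%R ->
  fractional_gradient mu s twoB0 u g ->
  average mu B0 (fun x =>
    expeR ((trudinger_rate s p Q b * b `^ Q^-1)%:E *
           (`|u x - average mu B0 u| / lq_Lp_norm mu p q twoB0 g))) <=
  ((2 `^ p) ^+ 2 * expR ((2 `^ p) ^+ 2 * 2) * 2)%:E.
Proof.
move=> spQ gradg.
set C2 := (_ * _ * 2)%R.
have C21 : (1 <= C2)%R.
  have h1 : (1 <= (2 : R) `^ p)%R by rewrite ltW// powR2_gt1.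
  rewrite /C2 mulr_ege1 ?ler1n// mulr_ege1 ?exprn_ege1//.
  by apply: le_trans (expR_ge1Dx _); rewrite lerDl mulr_ge0// exprn_ge0// powR_ge0.
set L := chain_const s p Q; have L0 : (0 < L)%R by exact: chain_const_gt0.
have ln2 : (0 < ln (2:R))%R by rewrite ln_gt0// ltr1n.
have energy := integral_lp_gradient_le_norm mtwoB0 gradg q0 qp.
have A0 : 0 <= \int[mu]_(x in twoB0) lp_gradient p g x.
  by apply: integral_ge0 => x _; exact: lp_gradient_ge0.
set N := lq_Lp_norm mu p q twoB0 g in energy *.
have : 0 <= N by exact: poweR_ge0.
case: N energy => [N||] // energy; last first.
  move=> _; rewrite invey.
  apply: average_exp0 => //; last by apply: nearW => x _; rewrite mule0 mule0.
  under eq_fun do rewrite mule0 mule0.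
  exact: measurable_cst.
rewrite lee_fin le_eqVlt => /predU1P[N0|N0].
  have [|a ua] := zero_energy_const gradg.
    apply/eqP; rewrite eq_le A0 andbT (le_trans energy)// -N0 poweR0r// gt_eqF//.
  rewrite (average_eq_const ua) -N0 inve0.
  apply: average_exp0 => //; last first.
    by move: ua; apply: filterS => x + Bx => /(_ Bx) ->; rewrite subee// abse0 mul0e mule0.
  apply: measurable_funeM; apply: emeasurable_funM => //.
  exact: measurable_dist measurable_B0 a.
pose kappa := (2 * N / b `^ p^-1)%R.
have bp : (0 < b `^ p^-1)%R by rewrite powR_gt0.
have kap0 : (0 < kappa)%R by rewrite divr_gt0// mulr_gt0.
have [|a [h ctrl]] := control_of_energy gradg kap0.
  rewrite spQ.
  apply: (@le_lt_trans _ _ ((N `^ p)%:E * (r0 `^ Q)%:E)).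
    by rewrite lee_wpmul2r// lee_fin powR_ge0.
  rewrite -EFinM lte_fin /kappa.
  rewrite (powRM _ (mulr_ge0 (ler0n R 2) (ltW N0))) ?invr_ge0 ?(ltW bp)//.
  rewrite (powRM _ (ler0n R 2) (ltW N0)) -(powR_inv1 (ltW bp)) -!powRrM mulN1r.
  rewrite mulrN mulVf ?gt_eqF// powR_inv1 ?(ltW b0)//.
  rewrite [ltRHS](_ : _ = 2 `^ p * (N `^ p * r0 `^ Q))%R; last by field; rewrite gt_eqF.
  by rewrite ltr_pMl ?mulr_gt0 ?powR_gt0// powR2_gt1.
have [m mE em] := average_exp_dist_le mB0 B0_pos B0_fin measurable_B0 p0
  (mulr_gt0 L0 kap0) ctrl (chain_growth_eq1 Q0 spQ).
rewrite mE.
rewrite [X in average mu B0 X](_ : _ =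
  (fun x => expeR ((p * ln 2 / (L * kappa))%:E * `|u x - m%:E|)))//.
apply/funext => x; congr expeR.
rewrite muleCA muleC inver gt_eqF// -EFinM; congr (_%:E * _).
rewrite /trudinger_rate -/L /kappa; field.
by rewrite !gt_eqF// powR_gt0.
Qed.

End assembly.

Theorem theorem4p1 (R : realType) (s p q Q : R)
    (s_gt0 : (0 < s)%R) (p_gt0 : (0 < p)%R) (q_gt0 : (0 < q)%R)
    (le_qp : (q <= p)%R) (Q_gt0 : (0 < Q)%R) :
  exists (C : R) (C1 : R -> R) (C2 C3 : R),
    [/\ (0 < C)%R, forall b : R, (0 < b)%R -> (0 < C1 b)%R,
        (0 < C2)%R & (0 < C3)%R] /\
    forall (d : measure_display) (X : metricMeasurableType d R)
      (mu : {measure set X -> \bar R}) (x0 : X) (r0 b : R)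
      (u : X -> \bar R) (g : int -> X -> \bar R),
    let B0 := ball x0 r0 in
    let twoB0 := ball x0 (2 * r0)%R in
    metric_measure_space mu ->
    (0 < r0)%R -> (0 < b)%R ->
    (forall (x : X) (r : R), (0 < r)%R -> ball x r `<=` twoB0 ->
       (b * r `^ Q)%:E <= mu (ball x r)) ->
    hajlasz_besov mu s p q twoB0 u ->
    (twoB0 = [set x0] -> u x0 \is a fin_num) ->
    fractional_gradient mu s twoB0 u g ->
    let K := (mu twoB0 / (b * r0 `^ Q)%:E) `^ p^-1 * (r0 `^ s)%:E *
      (\esum_(j in [set: int])
         (average mu twoB0 (fun x => g j x `^ p)) `^ (q / p)) `^ q^-1 in
    [/\ (s * p < Q)%R ->
          let pstar := (Q * p / (Q - s * p))%R in
          in_Lp mu pstar B0 u /\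
          ereal_inf
            [set (average mu B0 (fun x => `|u x - a%:E| `^ pstar)) `^ pstar^-1
               | a in [set: R]]
          <= C%:E * K,
        (s * p = Q)%R ->
          average mu B0 (fun x =>
            expeR ((C1 b * b `^ Q^-1)%:E *
                   (`|u x - average mu B0 u| / lq_Lp_norm mu p q twoB0 g)))
          <= C2%:E &
        (Q < s * p)%R ->
          'N[mu]_+oo[(fun x => u x - average mu B0 u) \_ B0] <= C3%:E * K].
Proof.
have spt (x : R) : (0 < 1 + `|x|)%R by rewrite ltr_pwDl.
have L0 : (0 < chain_const s p Q)%R by exact: chain_const_gt0.
(* The constants are chosen before the regime is known; the absolute values
   keep them positive in the regimes that they do not serve. *)
exists (chain_const s p Q * (1 + `|(chain_growth s p Q - 1)^-1|) *
         (2 `^ p * 2) `^ (Q * p / (Q - s * p))^-1)%R,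
  (trudinger_rate s p Q),
  ((2 `^ p) ^+ 2 * expR ((2 `^ p) ^+ 2 * 2) * 2)%R,
  (chain_const s p Q * (2 * (1 + `|(1 - chain_growth s p Q)^-1|)))%R.
have D0 : (0 < (2 : R) `^ p)%R by rewrite powR_gt0.
split.
  split.
  - by rewrite mulr_gt0 ?powR_gt0 ?(mulr_gt0 L0) ?(mulr_gt0 D0).
  - move=> b b0; have ln2 : (0 < ln (2:R))%R by rewrite ln_gt0// ltr1n.
    rewrite /trudinger_rate divr_gt0 ?powR_gt0// mulr_gt0 ?powR_gt0//.
    by rewrite divr_gt0 ?(mulr_gt0 p_gt0 ln2)// mulr_gt0.
  - by rewrite !mulr_gt0 ?exprn_gt0 ?expR_gt0.
  - by rewrite (mulr_gt0 L0)// mulr_gt0.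
move=> d X mu x0 r0 b u g B0 twoB0 mms r00 b0 lower hb ux0 gradg K.
have meas_u := proj1 hb; split.
- by move=> spQ pstar; exact: sobolev_case.
- by move=> spQ; exact: trudinger_case.
- by move=> spQ; exact: morrey_case.
Qed.
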